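(* Let $G$ be a finite nilpotent group with $\alpha(G)=\frac{3}{4}$. Then $G$ is a $2$-group, and at least one of the following holds: (i) $G'=\Phi(G)$; or (ii) there is $n\in\mathbb{N}$ such that $\frac{G}{G'}\cong \mathbb{Z}_2^n\times \mathbb{Z}_4$ and $G'$ is elementary abelian.
   Context: For a finite group $G$, $L_1(G)$ denotes the set (poset) of cyclic subgroups of $G$ (including the trivial subgroup), and $\alpha(G)=\frac{|L_1(G)|}{|G|}$. $G'$ is the commutator (derived) subgroup and $\Phi(G)$ the Frattini subgroup of $G$. $\mathbb{Z}_m$ is the cyclic group of order $m$, and $\mathbb{N}$ includes $0$. *)

(* Defs.v *)
From mathcomp Require Import all_boot all_order all_fingroup all_algebra all_solvable.

Set Implicit Arguments.
Unset Strict Implicit.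
Unset Printing Implicit Defensive.

Import GroupScope.

Definition cyclic_subgroups (gT : finGroupType) (G : {group gT}) :
    {set {group gT}} :=
  [set H in subgroups G | cyclic H].

Definition alpha (gT : finGroupType) (G : {group gT}) : rat :=
  (#|cyclic_subgroups G|%:R / #|G|%:R)%R.

(* 'Z_2 and 'Z_4 carry their additive group structure, and row vectors over
   'Z_2 the componentwise one, so this is the direct product Z_2^n x Z_4. *)
Definition Z2n_x_Z4 (n : nat) : {group 'rV['Z_2]_n * 'Z_4} :=
  [set: 'rV['Z_2]_n * 'Z_4]%G.

(* Main.v *)
Require Import Defs.
From mathcomp Require Import all_boot all_order all_fingroup all_algebra all_solvable.
From mathcomp Require Import mxabelem.

Import GroupScope.

(** A cyclic group of order at least 3 has at least two generators, because a
generator and its inverse are then distinct. Counting the elements of [G] by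
the cyclic subgroup that they generate therefore gives
[2 * #cyclic subgroups <= #|G| + #|I|], where [I = 'Ldiv_2(G)] is the set of
solutions of [x ^+ 2 = 1]. If the ratio is 3/4, then at least half of the
elements of [G] lie in [I] ([leq_card_Ldiv2]); everything else follows from
this inequality.

In a nilpotent group [G = 'O_2(G) \x 'O_2^'(G)] we have [I \subset 'O_2(G)],
so the odd factor has order at most 2, that is, 1 ([half_Ldiv2_2group]).

Let now [G] be a 2-group, and let [T] be the preimage in [G] of ['Ohm_1] of
the abelianisation: the elements whose square lies in [G^`(1)]. It is a
subgroup containing [I], so its index is 1 or 2 ([half_Ldiv2_quotient]). If
the index is 1, then [G / G^`(1)] is elementary abelian, hence
['Phi(G) = G^`(1)]. If the index is 2, then [I] and [T] have the same order, so [I = T] contains [G^`(1)],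
which is thus elementary abelian; and an abelian 2-group in which ['Ohm_1] has
index 2 is the product of a cyclic group of order 4 and an elementary abelian
group ([isog_Z2n_x_Z4]). *)

(** * Counting cyclic subgroups *)

(** Each cyclic subgroup [H] receives weight at least 2 when a generator [x]
counts for [1 + (x ^+ 2 == 1)]: either [x ^+ 2 = 1], and [x] alone has weight
2, or [x] differs from its inverse, which also generates [H]. *)
Lemma double_cyclic_subgroups_leq (gT : finGroupType) (G : {group gT}) :
  #|cyclic_subgroups G| * 2 <= #|G| + #|'Ldiv_2(G)|.
Proof.
have ->: #|G| + #|'Ldiv_2(G)| = \sum_(x in G) (1 + (x ^+ 2 == 1)%g).
  rewrite big_split sum1_card /=; congr (_ + _).
  rewrite -sum1_card big_mkcond [RHS]big_mkcond; apply: eq_bigr => x _.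
  by rewrite !inE; case: (x \in G); case: (_ == 1).
rewrite (partition_big (fun x => <[x]>%G) (mem (cyclic_subgroups G))); last first.
  by move=> x Gx; rewrite !inE cycle_subG Gx cycle_cyclic.
rewrite -sum_nat_const; apply: leq_sum => H; rewrite !inE.
case/andP=> sHG /cyclicP[a defH].
have Ga: a \in G by rewrite -cycle_subG -defH.
have genH b: <[b]> = <[a]> -> <[b]>%G == H.
  by move=> eq_ba; apply/eqP/val_inj; rewrite /= eq_ba defH.
rewrite (bigD1 a) ?Ga ?genH //=.
have [//|a2neq1] := eqVneq (a ^+ 2) 1.
rewrite (bigD1 a^-1) /= ?leq_add //.
rewrite groupV Ga genH ?cycleV //=.
by apply: contraNneq a2neq1 => Da; rewrite expgS expg1 -{2}Da mulgV.
Qed.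

Lemma leq_card_Ldiv2 (gT : finGroupType) (G : {group gT}) :
  alpha G = (3%:R / 4%:R)%R -> #|G| <= 2 * #|'Ldiv_2(G)|.
Proof.
move=> /eqP; rewrite /alpha GRing.eqr_div ?Num.Theory.pnatr_eq0 -?lt0n //.
rewrite -!GRing.natrM Num.Theory.eqr_nat => /eqP Dcyc.
(* With c cyclic subgroups, g = #|G| and i = #|'Ldiv_2(G)|, twice the bound 2c <= g + i reads
   3g = 4c <= 2g + 2i. *)
rewrite -(leq_add2l (2 * #|G|)) -mulSnr -Dcyc -mulnDr (mulnA _ 2 2) mulnC.
by rewrite leq_pmul2l // double_cyclic_subgroups_leq.
Qed.

(** * Groups in which at least half of the elements square to 1 *)

Lemma half_Ldiv2_2group (gT : finGroupType) (G : {group gT}) :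
  nilpotent G -> #|G| <= 2 * #|'Ldiv_2(G)| -> 2.-group G.
Proof.
move=> nilG leGI; have defG := nilpotent_pcoreC 2 nilG.
have sIO: 'Ldiv_2(G) \subset 'O_2(G).
  apply/subsetP=> x /LdivP[Gx x2].
  rewrite (mem_normal_Hall (nilpotent_pcore_Hall _ nilG)) ?pcore_normal //.
  by rewrite /p_elt (pnat_dvd (_ : #[x] %| 2)) // order_dvdn x2.
have leO2: #|'O_2^'(G)| <= 2.
  rewrite -(leq_pmul2l (cardG_gt0 'O_2(G)%G)) (dprod_card defG).
  by rewrite (leq_trans leGI) // mulnC leq_pmul2r // subset_leq_card.
have oddO: odd #|'O_2^'(G)| by rewrite odd_2'nat; apply: pcore_pgroup.
have /eqP O1: 'O_2^'(G) == 1.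
  rewrite trivg_card_le1; move: leO2 oddO.
  by case: #|_| => [|[|[|]]].
by move: defG; rewrite O1 dprodg1 => <-; apply: pcore_pgroup.
Qed.

Lemma abelem_exponent2 (gT : finGroupType) (H : {group gT}) :
  exponent H %| 2 -> 2.-abelem H.
Proof.
move=> eH; rewrite abelemE // eH andbT.
have invH x: x \in H -> x^-1 = x.
  move=> Hx; apply/eqP; rewrite eq_invg_mul -[x * x]/(x ^+ 2) -order_dvdn.
  exact: dvdn_trans (dvdn_exponent Hx) eH.
apply/centsP=> x Hx y Hy; rewrite /commute.
by rewrite -[x * y]invH ?groupM // invMg !invH.
Qed.

(** A cyclic factor [<[x]>] of maximal order splits off [A], and the squares
form the group ['Mho^1(A)] of order [#|A : 'Ohm_1(A)| = 2]. Hence [x] has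
order 4, and the complement is elementary abelian: a nontrivial square in it
would be [x ^+ 2], but it meets [<[x]>] trivially. *)
Lemma isog_Z2n_x_Z4 (gT : finGroupType) (A : {group gT}) :
  2.-group A -> abelian A -> #|A : 'Ohm_1(A)| = 2 ->
  exists n, A \isog Z2n_x_Z4 n.
Proof.
move=> pA cAA indA.
have oM: #|'Mho^1(A)| = 2.
  apply/eqP; rewrite -(eqn_pmul2l (cardG_gt0 'Ohm_1(A)%G)).
  by rewrite mul_card_Ohm_Mho_abelian // -indA Lagrange ?Ohm_sub.
have sqM y: y \in A -> y ^+ 2 \in 'Mho^1(A).
  by move=> Ay; apply: (Mho_p_elt 1 Ay); apply: mem_p_elt Ay.
have sq4 y: y \in A -> y ^+ 4 = 1.
  by move=> Ay; rewrite (expgM y 2 2) -[in X in _ ^+ X]oM expg_cardG ?sqM.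
have sq_eq y z: y \in A -> z \in A -> y ^+ 2 != 1 -> z ^+ 2 != 1 ->
    y ^+ 2 = z ^+ 2.
  move=> /sqM My /sqM Mz y2 z2; apply/eqP; apply: contraT => neq_yz.
  have: [set 1; y ^+ 2; z ^+ 2] \subset 'Mho^1(A).
    by apply/subsetP=> t; rewrite !inE => /orP[/orP[]|] /eqP-> //; rewrite group1.
  move/subset_leq_card; rewrite oM -setUA cardsU1 cards2 !inE neq_yz.
  by rewrite ![1 == _]eq_sym (negPf y2) (negPf z2).
have [H /(_ cAA)[x ox defA]] := abelian_type_subproof A.
have [_ defAm _ tixH] := dprodP defA; have [sxA sHA] := mulG_sub defAm.
have Ax: x \in A by rewrite -cycle_subG.
have x2: x ^+ 2 != 1.
  apply/negP; rewrite -order_dvdn ox => eA.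
  have abA: 2.-abelem A by rewrite abelemE // cAA.
  by move: indA; rewrite (Ohm1_id abA) indexgg.
have o4: #[x] = 4.
  apply/eqP; rewrite eqn_dvd order_dvdn sq4 // eqxx.
  have := mem_p_elt pA Ax; rewrite /p_elt => /p_natP[k Dk].
  move: x2; rewrite -order_dvdn Dk; case: k {Dk} => [|[|k]] // _.
  by rewrite !expnS mulnA dvdn_mulr.
have abH: 2.-abelem H.
  rewrite abelemE // (abelianS sHA) //=; apply/exponentP=> y Hy.
  apply/eqP; apply: contraT => y2; have Ay := subsetP sHA y Hy.
  have: x ^+ 2 \in <[x]> :&: H.
    by rewrite inE mem_cycle (sq_eq _ y) // groupX.
  by rewrite tixH inE (negPf x2).
have [n oH] := p_natP (abelem_pgroup abH).
exists n; have defAC: H \x <[x]> = A by rewrite dprodC.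
have defZ: setX [set: 'rV['Z_2]_n] 1 \x setX 1 [set: 'Z_4] = Z2n_x_Z4 n.
  by rewrite setX_dprod; apply/setP=> u; rewrite !inE.
apply: (isog_dprod defAC defZ).
  apply: isog_trans (isog_setX1 _ _).
  rewrite (isog_abelem_card _ abH) cardsT card_mx mul1n card_ord oH eqxx andbT.
  exact: (@mx_Fp_abelem 2 1 n isT).
apply: isog_trans (isog_set1X _ _).
rewrite isog_cyclic_card ?cycle_cyclic // cardsT card_ord -orderE o4 eqxx andbT.
by apply/cyclicP; exists Zp1; apply: Zp_cycle.
Qed.

(** Passing to an abelian quotient [G / N] of a 2-group: the elements squaring
to 1 lie in the preimage of ['Ohm_1(G / N)], which is a subgroup, so it has
index at most 2, and for index 2 it consists of such elements only. *)
Lemma half_Ldiv2_quotient (gT : finGroupType) (G N : {group gT}) :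
    2.-group G -> N <| G -> abelian (G / N) -> #|G| <= 2 * #|'Ldiv_2(G)| ->
  2.-abelem (G / N) \/
  #|G / N : 'Ohm_1(G / N)| = 2 /\ N \subset 'Ldiv_2(G).
Proof.
move=> pG nsNG abQ leGI; have pQ := quotient_pgroup N pG.
have [sNG nNG] := andP nsNG.
have abO := Ohm1_abelem pQ abQ.
pose T := (coset N @*^-1 'Ohm_1(G / N))%G.
have sTG: T \subset G by rewrite sub_cosetpre_quo ?Ohm_sub.
have indT: #|G : T| = #|G / N : 'Ohm_1(G / N)|.
  by rewrite -{1}(quotientGK nsNG) index_cosetpre.
have sIT: 'Ldiv_2(G) \subset T.
  apply/subsetP=> x /LdivP[Gx x2]; have Nx := subsetP nNG x Gx.
  rewrite mem_morphpre //= (OhmEabelian pQ (abelem_abelian abO)).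
  by apply/LdivP; rewrite mem_quotient // -morphX // x2 morph1.
have le2: #|G : T| <= 2.
  rewrite -(leq_pmul2l (cardG_gt0 T)) Lagrange // (leq_trans leGI) //.
  by rewrite mulnC leq_pmul2r // subset_leq_card.
have [i1|i_neq1] := eqVneq #|G : T| 1%N.
  left; suff <-: 'Ohm_1(G / N) = G / N by [].
  by apply/eqP; rewrite eqEsubset Ohm_sub -indexg_eq1 -indT i1.
right; have i2: #|G : T| = 2.
  by move: le2 i_neq1 (indexg_gt0 G T); case: #|_ : _| => [|[|[|]]].
split; first by rewrite -indT.
(* #|G| = 2 * #|T| now turns the hypothesis into #|T| <= #|'Ldiv_2(G)|. *)
suff ->: 'Ldiv_2(G) = T by apply: sub_cosetpre.
apply/eqP; rewrite eqEcard sIT /=.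
by rewrite -(leq_pmul2r (_ : 0 < 2)) // -{1}i2 Lagrange // mulnC.
Qed.

(** * Nilpotent groups with cyclic subgroup ratio 3/4 *)

Theorem theorem2p6 (gT : finGroupType) (G : {group gT}) :
  nilpotent G -> alpha G = (3%:R / 4%:R)%R ->
  2.-group G /\
  (G^`(1) = 'Phi(G) \/
   ((exists n : nat, G / G^`(1) \isog Z2n_x_Z4 n) /\ 2.-abelem G^`(1))).
Proof.
move=> nilG /leq_card_Ldiv2 leGI.
have pG := half_Ldiv2_2group _ _ nilG leGI; split=> //.
have nsG'G: G^`(1) <| G := der_normal 1 G.
have abQ: abelian (G / G^`(1)) := der_abelian 0 G.
have pQ := quotient_pgroup G^`(1) pG.
have [abelQ | [indQ sG'I]] := half_Ldiv2_quotient _ _ _ pG nsG'G abQ leGI.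
  left; apply/eqP; rewrite eqEsubset (Phi_min pG _ abelQ) ?normal_norm // andbT.
  by rewrite (Phi_joing pG) joing_subl.
right; split; first exact: isog_Z2n_x_Z4.
by apply: abelem_exponent2; rewrite -sub_LdivT (subset_trans sG'I) ?subsetIr.
Qed.
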